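(* For every $n\in\mathbb{N}$ (that is, $n \ge 1$), there exists a right-equidistant sequence of $4n-1$ points in $\mathbb{R}_1^n$.
   Context: $\mathbb{R}^n_{1}$ denotes $\mathbb{R}^n$ equipped with the Manhattan metric $\|\mathbf{x}-\mathbf{y}\|_{1} = \sum_{i=1}^n |x_i-y_i|$. A sequence $\mathbf{x}^{(1)},\dots,\mathbf{x}^{(m)}$ of distinct points in $\mathbb{R}^n_1$ is called right-equidistant if $\|\mathbf{x}^{(j_1)}-\mathbf{x}^{(i)}\|_{1} = \|\mathbf{x}^{(j_2)}-\mathbf{x}^{(i)}\|_{1}$ for all $1 \le i < j_1 \le j_2 \le m$; that is, each point of the sequence is at the same distance from all the succeeding points. *)

(* Defs.v *)
From mathcomp Require Import all_boot all_order all_algebra.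
From mathcomp Require Import reals.

Set Implicit Arguments.
Unset Strict Implicit.
Unset Printing Implicit Defensive.

Import Order.TTheory GRing.Theory Num.Theory.

Local Open Scope ring_scope.

(* The norm that MathComp-Analysis puts on row vectors is the sup norm, hence
   this explicit Manhattan distance. *)
Definition dist1 (R : realType) (n : nat) (x y : 'rV[R]_n) : R :=
  \sum_(i < n) `|x ord0 i - y ord0 i|.

(* Indices run over 0, ..., m - 1 instead of 1, ..., m. *)
Definition right_equidistant (R : realType) (n m : nat)
    (x : 'I_m -> 'rV[R]_n) : Prop :=
  injective x /\
  forall i j1 j2 : 'I_m, (i < j1)%N -> (j1 <= j2)%N ->
    dist1 (x j1) (x i) = dist1 (x j2) (x i).

(* Main.v *)
(** Call a pair p, q with d(p, q) = D a cap of a set S when every x in S satisfies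
    d(p, x) = D and d(q, x) = 2 D; then p, q can be put in front of a
    right-equidistant enumeration of S.  Inside a simplex
    {x >= b, x_0 + ... + x_(n-1) = s} there is a cap of a smaller simplex lying
    in a facet; descending on the dimension gives 2 n - 1 points.  Likewise, the
    part of the cross-polytope of radius s where x_i >= b_i for i < k (and
    b_i = 0 otherwise) contains a cap of a part of the same kind with k + 1
    constrained coordinates; for k = n - 1, ..., 1 this adds 2 (n - 1) points to
    those of the simplex k = n.  For k = 0 a cap still exists, the centre of the
    cross-polytope and a vertex, giving 4 n - 1. *)
Require Import Defs.
From mathcomp Require Import all_boot all_order all_algebra.
From mathcomp Require Import reals.
From mathcomp Require Import zify ring lra.

Set Implicit Arguments.
Unset Strict Implicit.
Unset Printing Implicit Defensive.

Import Order.TTheory GRing.Theory Num.Theory.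
Local Open Scope ring_scope.

(** * Right-equidistant lists *)

(** A list can be extended at its front, which is where caps go. The condition [0 < D] is what makes
    the points distinct. *)
Fixpoint right_eqd (R : realType) (n : nat) (S : seq 'rV[R]_n) : Prop :=
  if S is x :: S' then
    (exists2 D, 0 < D & {in S', forall y, dist1 y x = D}) /\ right_eqd S'
  else True.

Lemma right_eqd_nth (R : realType) n (S : seq 'rV[R]_n) (i : nat) :
  right_eqd S ->
  exists2 D, 0 < D & forall j, (i < j < size S)%N ->
    dist1 (nth 0 S j) (nth 0 S i) = D.
Proof.
elim: S i => [|x S IHS] i /=; first by move=> _; exists 1 => // j; lia.
case=> [[D D0 HD] HS]; case: i => [|i].
  exists D => // -[//|j] /= jS; exact/HD/mem_nth.
have [E E0 HE] := IHS i HS; exists E => // -[//|j] /= jS; exact: HE.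
Qed.

Lemma right_eqd_cap (R : realType) n (S : seq 'rV[R]_n) p q D : 0 < D ->
  dist1 q p = D ->
  {in S, forall x, dist1 x p = D /\ dist1 x q = 2 * D} ->
  right_eqd S -> right_eqd [:: p, q & S].
Proof.
move=> D0 qp HS eqS; split.
  by exists D => // x; rewrite in_cons => /predU1P[->//|/HS[]].
split=> //; exists (2 * D); first lra.
by move=> x /HS[].
Qed.

Lemma right_eqd_equidistant (R : realType) n m (S : seq 'rV[R]_n) :
  size S = m -> right_eqd S ->
  right_equidistant (fun i : 'I_m => nth 0 S i).
Proof.
move=> sizeS eqS; split=> [i j|i j1 j2 ij1 j12].
  wlog ij : i j / (i < j)%N => [wlog_lt xij|xij].
    have [ij|ji|//] := ltngtP i j; last exact/val_inj.
      exact: wlog_lt.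
    by apply/esym/wlog_lt.
  have [D D0 HD] := right_eqd_nth i eqS.
  have /HD : (i < j < size S)%N by rewrite ij sizeS /=.
  rewrite xij /dist1 big1 => [D0'|k _]; last by rewrite subrr normr0.
  by rewrite -D0' ltxx in D0.
have [D _ HD] := right_eqd_nth i eqS.
by rewrite !HD // ?sizeS ?ltn_ord ?andbT //; lia.
Qed.

(** * Translates along basis vectors and caps in simplices *)

Section Caps.
Variables (R : realType) (m : nat).
Implicit Types (b x : 'rV[R]_m.+1) (s : R) (k : nat) (S : seq 'rV[R]_m.+1).

Local Notation e j := (delta_mx (ord0 : 'I_1) j : 'rV[R]_m.+1).

Lemma sum_delta (j : 'I_m.+1) (a : R) : \sum_i a * (e j) ord0 i = a.
Proof.
rewrite (bigD1 j) //= big1 => [|i ij]; first by rewrite mxE !eqxx mulr1 addr0.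
by rewrite mxE (negPf ij) andbF mulr0.
Qed.

Lemma delta_neq (i j : 'I_m.+1) : i != j :> nat -> (e j) ord0 i = 0.
Proof. by move=> ij; rewrite mxE eqxx -val_eqE (negPf ij). Qed.

Lemma scale_delta_ge0 (a : R) (i j : 'I_m.+1) : 0 < a -> 0 <= a * (e j) ord0 i.
Proof. by move=> a0; rewrite mulr_ge0 ?mxE // ltW. Qed.

Lemma shiftE b (a : R) (i j : 'I_m.+1) :
  (b + a *: e j) ord0 i = b ord0 i + a * (e j) ord0 i.
Proof. by rewrite mxE; congr (_ + _); rewrite mxE. Qed.

Lemma shiftNE b (a : R) (i j : 'I_m.+1) :
  (b - a *: e j) ord0 i = b ord0 i - a * (e j) ord0 i.
Proof. by rewrite -scaleNr shiftE mulNr. Qed.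

(** Keeping the coordinates beyond [k] at their lower bounds confines the smaller simplex to a
    facet, which leaves a fresh direction for the next cap. *)
Lemma simplex_eqd k b s : (k <= m)%N -> \sum_i b ord0 i < s ->
  exists S, [/\ size S = k.*2.+1, right_eqd S &
    {in S, forall x, [/\ \sum_i x ord0 i = s, forall i, b ord0 i <= x ord0 i
      & forall i : 'I_m.+1, (k < i)%N -> x ord0 i = b ord0 i]}].
Proof.
elim: k b s => [|k IHk] b s km bs; pose D := s - \sum_i b ord0 i;
  have D0 : 0 < D by rewrite subr_gt0.
  exists [:: b + D *: e ord0]; split=> //=; first by split=> //; exists 1.
  move=> x; rewrite inE => /eqP->; split.
  - under eq_bigr do rewrite shiftE.
    by rewrite big_split /= sum_delta /D; ring.
  - by move=> i; rewrite shiftE lerDl scale_delta_ge0.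
  - by move=> i i0; rewrite shiftE delta_neq ?mulr0 ?addr0 // -lt0n.
pose j : 'I_m.+1 := inord k.+1.
have jE : j = k.+1 :> nat by rewrite inordK.
(* Raising the bound at coordinate 0 halves the slack [D]. *)
pose c := b + (D / 2) *: e ord0.
have sc : \sum_i c ord0 i = s - D / 2.
  under eq_bigr do rewrite shiftE.
  by rewrite big_split /= sum_delta /D; field.
have [||S [sizeS eqS HS]] := IHk c s; [lia|by rewrite sc; lra|].
pose p := c + (D / 2) *: e j; pose q := b + D *: e j.
have cE i : c ord0 i = b ord0 i + D / 2 * (e ord0) ord0 i.
  exact: shiftE.
have pE i : p ord0 i = c ord0 i + D / 2 * (e j) ord0 i.
  exact: shiftE.
have qE i : q ord0 i = b ord0 i + D * (e j) ord0 i.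
  exact: shiftE.
have sp : \sum_i p ord0 i = s.
  under eq_bigr => i _ do rewrite pE.
  by rewrite big_split /= sum_delta sc; field.
have sq : \sum_i q ord0 i = s.
  under eq_bigr => i _ do rewrite qE.
  by rewrite big_split /= sum_delta /D; ring.
have ej (i : 'I_m.+1) : (e j) ord0 i = if i == j then 1 else 0.
  by rewrite mxE eqxx; case: ifP.
have e0j : (e ord0) ord0 j = 0 by rewrite delta_neq ?jE.
have D2 : 0 < D / 2 by rewrite divr_gt0.
have bc i : b ord0 i <= c ord0 i by rewrite cE lerDl scale_delta_ge0.
exists [:: p, q & S]; split; first by rewrite /= sizeS doubleS.
(* All points have sum [s] and the differences below are negative at [j] only, so each distance is
   twice the gap there: [D / 2] between [p] and [q] or [p] and [x], [D] between [q] and [x]. *)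
- apply: (right_eqd_cap D0) => //.
    transitivity (\sum_i (p ord0 i - q ord0 i + D * (e j) ord0 i)).
      apply: eq_bigr => i _; rewrite distrC pE qE ej.
      case: (eqVneq i j) => [->|_] /=.
        rewrite cE e0j ler0_norm; lra.
      by rewrite ger0_norm; have := bc i; lra.
    by rewrite big_split sumrB /= sp sq sum_delta; ring.
  move=> x /HS[sx cx xb].
  have xj : x ord0 j = b ord0 j by rewrite xb ?jE // cE e0j; ring.
  split.
    transitivity (\sum_i (x ord0 i - p ord0 i + D * (e j) ord0 i)).
      apply: eq_bigr => i _; rewrite pE ej.
      case: (eqVneq i j) => [->|_] /=.
        rewrite xj cE e0j ler0_norm; lra.
      by rewrite ger0_norm; have := cx i; lra.
    by rewrite big_split sumrB /= sp sx sum_delta; ring.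
  transitivity (\sum_i (x ord0 i - q ord0 i + 2 * D * (e j) ord0 i)).
    apply: eq_bigr => i _; rewrite qE ej.
    case: (eqVneq i j) => [->|_] /=.
      rewrite xj ler0_norm; lra.
    by rewrite ger0_norm; have := cx i; have := bc i; lra.
  by rewrite big_split sumrB /= sq sx sum_delta; ring.
- have fixed (i : 'I_m.+1) : (k.+1 < i)%N -> c ord0 i = b ord0 i /\ (i == j) = false.
    move=> ki; split; last by apply/eqP => ij; rewrite ij jE ltnn in ki.
    by rewrite cE delta_neq ?mulr0 ?addr0 // -lt0n (ltn_trans _ ki).
  move=> x; rewrite !inE => /or3P[/eqP->|/eqP->|/HS[sx cx xb]].
  + split=> // i => [|/fixed[ci ij]]; last by rewrite pE ej ij ci mulr0 addr0.
    by rewrite pE (le_trans (bc i)) // lerDl scale_delta_ge0.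
  + split=> // i => [|/fixed[ci ij]]; last by rewrite qE ej ij mulr0 addr0.
    by rewrite qE lerDl scale_delta_ge0.
  + split=> // i; first exact: le_trans (bc i) (cx i).
    by move=> /[dup]/fixed[ci _] ki; rewrite xb ?ci //; lia.
Qed.

(** * Cells of the cross-polytope *)

(** Constrained coordinates enter the sum with their sign, so [k = m.+1] gives the simplex. For
    nonnegative [b] the sum is the Manhattan norm of [x]. *)
Definition in_cell k b s x :=
  (forall i : 'I_m.+1, (i < k)%N -> b ord0 i <= x ord0 i) /\
  \sum_(i < m.+1) (if (i < k)%N then x ord0 i else `|x ord0 i|) = s.

(* For [j = 0] and [b = 0], [p] is the origin, which leaves the sphere of radius
   [s]; this is why the cap ends the construction there. *)
Lemma cell_cap (j : 'I_m.+1) b s S (D := s - \sum_i b ord0 i)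
    (c := b + (D / 2) *: e ord0)
    (p := c - (D / 2) *: e j) (q := b - D *: e j) :
  0 < D -> (forall i : 'I_m.+1, (j <= i)%N -> b ord0 i = 0) ->
  {in S, forall x, in_cell j.+1 c s x} -> right_eqd S ->
  right_eqd [:: p, q & S].
Proof.
move=> D0 b0 HS eqS.
have cE i : c ord0 i = b ord0 i + D / 2 * (e ord0) ord0 i.
  exact: shiftE.
have pE i : p ord0 i = c ord0 i - D / 2 * (e j) ord0 i.
  exact: shiftNE.
have qE i : q ord0 i = b ord0 i - D * (e j) ord0 i.
  exact: shiftNE.
have De (i j' : 'I_m.+1) : 0 <= D * (e j') ord0 i.
  exact: scale_delta_ge0.
have e0 (i j' : 'I_m.+1) : (j' < i)%N -> (e j') ord0 i = 0.
  by move=> ji; rewrite delta_neq // gtn_eqF.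
have sb : \sum_i b ord0 i = s - D by rewrite /D; ring.
have sp : \sum_i p ord0 i = s - D.
  under eq_bigr do rewrite pE cE.
  by rewrite sumrB big_split /= !sum_delta sb; ring.
have sq : \sum_i q ord0 i = s - 2 * D.
  under eq_bigr => i _ do rewrite qE.
  by rewrite sumrB /= sum_delta sb; ring.
(* Up to index [j], [q <= p <= x] coordinatewise; beyond it [p] and [q] vanish. Each distance is
   thus a difference of two of the sums [s], [s - D], [s - 2 * D]. *)
apply: (right_eqd_cap D0) => //.
  transitivity (\sum_i (p ord0 i - q ord0 i)).
    apply: eq_bigr => i _; rewrite distrC ger0_norm // pE cE qE.
    by have := De i ord0; have := De i j; lra.
  by rewrite sumrB sp sq; ring.
move=> x /HS[cx sx]; split.
  transitivity (\sum_(i < m.+1)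
    ((if (i < j.+1)%N then x ord0 i else `|x ord0 i|) - p ord0 i)).
    apply: eq_bigr => i _; have [ij|ji] := ltnP i j.+1.
      by rewrite ger0_norm // pE; have := cx i ij; have := De i j; lra.
    by rewrite pE cE b0 1?ltnW // !e0 ?(leq_ltn_trans _ ji) // !mulr0 !addr0 !subr0.
  by rewrite sumrB sx sp; ring.
transitivity (\sum_(i < m.+1)
    ((if (i < j.+1)%N then x ord0 i else `|x ord0 i|) - q ord0 i)).
  apply: eq_bigr => i _; have [ij|ji] := ltnP i j.+1.
    rewrite ger0_norm // qE; have := cx i ij; rewrite cE.
    by have := De i j; have := De i ord0; lra.
  by rewrite qE b0 1?ltnW // !e0 // mulr0 !subr0.
by rewrite sumrB sx sq; ring.
Qed.

(** Induction on the number [l] of free coordinates, down to the simplex. As [0 < k], coordinate 0,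
    whose bound is raised, is never the free one being used. *)
Lemma cell_eqd l k b s : (k + l = m.+1)%N -> (0 < k)%N ->
  (forall i : 'I_m.+1, (k <= i)%N -> b ord0 i = 0) -> \sum_i b ord0 i < s ->
  exists S, [/\ size S = (l + m).*2.+1, right_eqd S &
    {in S, forall x, in_cell k b s x}].
Proof.
elim: l k b s => [|l IHl] k b s kl k0 b0 bs.
  have [S [sizeS eqS HS]] := simplex_eqd (leqnn m) bs.
  exists S; split=> // x /HS[sx bx _]; split=> //.
  rewrite -sx; apply: eq_bigr => i _.
  by have -> : (i < k)%N by rewrite -[k]addn0 kl.
pose D := s - \sum_i b ord0 i; have D0 : 0 < D by rewrite subr_gt0.
pose c := b + (D / 2) *: e ord0.
have km : (k < m.+1)%N by lia.
pose j := Ordinal km; have jE : j = k :> nat by [].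
have De (i j' : 'I_m.+1) : 0 <= D * (e j') ord0 i.
  exact: scale_delta_ge0.
have cE i : c ord0 i = b ord0 i + D / 2 * (e ord0) ord0 i.
  exact: shiftE.
have sc : \sum_i c ord0 i = s - D / 2.
  by under eq_bigr do rewrite cE; rewrite big_split /= sum_delta /D; field.
have c0 (i : 'I_m.+1) : (k <= i)%N -> c ord0 i = 0.
  by move=> ki; rewrite cE b0 // delta_neq ?mulr0 ?addr0 // -lt0n (leq_trans k0).
have [||i ki||S [sizeS eqS HS]] := IHl k.+1 c s.
- lia.
- by [].
- by apply: c0; lia.
- by rewrite sc; lra.
(* The entries at [j] are [- D / 2] and [- D]; their absolute values bring [p] and [q] back to the
   sphere of radius [s]. *)
pose p := c - (D / 2) *: e j; pose q := b - D *: e j.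
have pE i : p ord0 i = c ord0 i - D / 2 * (e j) ord0 i.
  exact: shiftNE.
have qE i : q ord0 i = b ord0 i - D * (e j) ord0 i.
  exact: shiftNE.
have ltj (i : 'I_m.+1) : (i < k)%N -> i != j :> nat.
  by move=> ik; rewrite jE ltn_eqF.
exists [:: p, q & S]; split; first by rewrite /= sizeS addSn doubleS.
  by apply: cell_cap => //; rewrite jE.
move=> x; rewrite !inE => /or3P[/eqP->|/eqP->|/HS[cx sx]]; split.
- move=> i ik; rewrite pE cE (@delta_neq i j) ?ltj //.
  by have := De i ord0; lra.
- transitivity (\sum_i (c ord0 i + D / 2 * (e j) ord0 i)).
    apply: eq_bigr => i _; rewrite pE; case: ltnP => [ik|ki].
      by rewrite delta_neq ?ltj // !mulr0 subr0 addr0.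
    by rewrite c0 // ler0_norm; have := De i j; lra.
  by rewrite big_split /= sum_delta sc; field.
- by move=> i ik; rewrite qE delta_neq ?ltj // mulr0 subr0.
- transitivity (\sum_i (b ord0 i + D * (e j) ord0 i)).
    apply: eq_bigr => i _; rewrite qE; case: ltnP => [ik|ki].
      by rewrite delta_neq ?ltj // !mulr0 subr0 addr0.
    by rewrite b0 // ler0_norm; have := De i j; lra.
  by rewrite big_split /= sum_delta /D; ring.
- move=> i ik; apply: le_trans (cx i (leqW ik)); rewrite cE.
  by have := De i ord0; lra.
(* At [i = k] the smaller cell has bound 0, so the signed entry equals its absolute value. *)
- rewrite -sx; apply: eq_bigr => i _; rewrite ltnS.
  case: (ltngtP i k) => // ik; rewrite ger0_norm //.
  by have := cx i; rewrite c0 ik ?leqnn //; apply.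
Qed.

(** * Counting the points *)

Lemma ex_right_eqd : exists S : seq 'rV[R]_m.+1,
  size S = (4 * m.+1 - 1)%N /\ right_eqd S.
Proof.
pose b : 'rV[R]_m.+1 := 0.
have sb : \sum_i b ord0 i = 0 by apply: big1 => i _; rewrite mxE.
(* Half of the first basis vector, in the form that [cell_cap] produces for radius 1. Its cell
   yields [4 * m + 1] points, and the last cap adds two. *)
pose c := b + ((1 - \sum_i b ord0 i) / 2) *: delta_mx ord0 ord0.
have [//||i i0||S [sizeS eqS HS]] := @cell_eqd m 1 c 1.
- lia.
- by rewrite shiftE mxE delta_neq ?mulr0 ?addr0 // -lt0n.
- under eq_bigr do rewrite shiftE.
  by rewrite big_split /= sum_delta sb; lra.
have eqT := @cell_cap ord0 b 1 S.
eexists; split; last apply: eqT => //.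
- by rewrite /= sizeS; lia.
- by rewrite sb; lra.
- by move=> i _; rewrite mxE.
Qed.

End Caps.

Local Close Scope ring_scope.

Theorem theorem3 (R : realType) (n : nat) (hn : (1 <= n)%N) :
  exists x : 'I_(4 * n - 1) -> 'rV[R]_n, right_equidistant x.
Proof.
case: n hn => // m _; have [S [sizeS eqS]] := ex_right_eqd R m.
by eexists; apply: right_eqd_equidistant sizeS eqS.
Qed.
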